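(* For all $\varepsilon\in(0,1/2)$, there is $n_0\in\mathbb{N}$ such that the following holds. Let $G$ be a graph with $n\geq n_0$ vertices and degeneracy $d$ such that $d\geq (\ln n)^{2/\varepsilon}$, and let $k\in\mathbb{N}$ satisfy $k\geq(1+\varepsilon)d/\ln d$. Then $G$ is $k$-DP-colorable with probability at least $1-\varepsilon$.
   Context: All graphs are finite and simple. $\mathbb{N}=\{0,1,2,\ldots\}$ and $[k]=\{1,\ldots,k\}$. A graph $G$ is $d$-degenerate if there is an ordering of $V(G)$ in which each vertex has at most $d$ neighbors among the preceding vertices; the degeneracy of $G$ is the smallest $d\in\mathbb{N}$ such that $G$ is $d$-degenerate. A (DP-)cover of $G$ is a pair $\mathcal{H}=(L,H)$ where $H$ is a graph and $L:V(G)\to 2^{V(H)}$ is such that: $\{L(v):v\in V(G)\}$ is a partition of $V(H)$ into $|V(G)|$ independent sets; for each edge $uv\in E(G)$ the edges of $H$ between $L(u)$ and $L(v)$ form a matching; and $H$ has no other edges than those between $L(u)$ and $L(v)$ with $uv\in E(G)$. A transversal is a set $T\subseteq V(H)$ containing exactly one vertex of each $L(v)$; it is independent if it is an independent set in $H$. $G$ is $\mathcal{H}$-colorable if $\mathcal{H}$ has an independent transversal. For $k\in\mathbb{N}$, the random $k$-fold cover $\mathcal{H}(G,k)=(L,H)$ is defined by $L(v)=\{(v,i):i\in[k]\}$ for $v\in V(G)$ and, independently for each edge $uv\in E(G)$, the edges of $H$ between $L(u)$ and $L(v)$ form a perfect matching chosen uniformly at random among the $k!$ perfect matchings between $L(u)$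 and $L(v)$ ($H$ has no other edges). We say $G$ is $k$-DP-colorable with probability $p$ if $\mathbb{P}(G\text{ is }\mathcal{H}(G,k)\text{-colorable})=p$ (and similarly for ''at most'', ''at least'', ''less than''). *)

(* Defs.v *)
From HB Require Import structures.
From mathcomp Require Import all_boot all_order all_algebra all_fingroup.
From mathcomp Require Import reals exp.
Set Implicit Arguments.
Unset Strict Implicit.
Unset Printing Implicit Defensive.
Import Order.TTheory GRing.Theory Num.Theory.

Record sgraph := SGraph {
  vertex :> finType;
  adj : rel vertex;
  adj_sym : symmetric adj;
  adj_irrefl : irreflexive adj }.

Section GraphOfEdges.
Variables (V : finType) (E : {set {set V}}).

(* Members of [E] that are not two-element sets are ignored. *)
Definition edge_rel : rel V := fun x y => (x != y) && ([set x; y] \in E).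

Lemma edge_rel_sym : symmetric edge_rel.
Proof. by move=> x y; rewrite /edge_rel eq_sym setUC. Qed.

Lemma edge_rel_irrefl : irreflexive edge_rel.
Proof. by move=> x; rewrite /edge_rel eqxx. Qed.

Definition graph_of_edges : sgraph := SGraph edge_rel_sym edge_rel_irrefl.
End GraphOfEdges.

Definition edges (G : sgraph) : {set {set G}} :=
  [set f | [exists u, exists v, adj u v && (f == [set u; v])]].

Notation edge G := {f : {set vertex G} | f \in edges G}.

Definition independent (G : sgraph) (S : {set G}) : bool :=
  [forall x in S, forall y in S, ~~ adj x y].

Definition degenerate (G : sgraph) (d : nat) : Prop :=
  exists s : seq G,
    [/\ uniq s, forall v, v \in s &
        forall v, #|[set u | adj u v & index u s < index v s]| <= d].

Definition is_degeneracy (G : sgraph) (d : nat) : Prop :=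
  degenerate G d /\ forall d', degenerate G d' -> d <= d'.

Record cover_data (G : sgraph) := CoverData {
  cover_graph : sgraph;
  cover_list : G -> {set cover_graph} }.

(* Empty lists are allowed, so that 0-fold covers are covers. *)
Definition is_dp_cover (G : sgraph) (C : cover_data G) : Prop :=
  [/\ forall x, exists! v, x \in cover_list C v,
      forall v, independent (cover_list C v),
      forall u v x, adj u v -> x \in cover_list C u ->
        #|[set y in cover_list C v | adj x y]| <= 1 &
      forall u v x y, x \in cover_list C u -> y \in cover_list C v ->
        adj x y -> adj u v].

Definition transversal (G : sgraph) (C : cover_data G)
    (S : {set cover_graph C}) : bool :=
  [forall v, #|S :&: cover_list C v| == 1].

Definition colorable (G : sgraph) (C : cover_data G) : bool :=
  [exists S : {set cover_graph C}, transversal S && independent S].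

Definition perfect_matching (V : finType) (A B : {set V})
    (M : {set {set V}}) : bool :=
  [&& [forall a in M, exists x in A, exists y in B, a == [set x; y]],
      trivIset M & cover M == A :|: B].

Section RandomCover.
Variables (G : sgraph) (k : nat).

Definition fiber (v : G) : {set G * 'I_k} := [set x | x.1 == v].

Definition matchings (f : {set G}) : {set {set {set G * 'I_k}}} :=
  [set M | [exists u, exists v,
     (f == [set u; v]) && perfect_matching (fiber u) (fiber v) M]].

(* An outcome assigns to every edge of [G] a set of pairs of vertices of the
   cover; [matching_law] below is supported on the outcomes all of whose values
   are perfect matchings. *)
Definition outcome := {ffun edge G -> {set {set G * 'I_k}}}.

Definition cover_of (w : outcome) : cover_data G :=
  @CoverData G (graph_of_edges (\bigcup_(f : edge G) w f)) fiber.

End RandomCover.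

Local Open Scope ring_scope.

Definition uniform_on (R : realType) (S : finType) (A : {set S}) (x : S) : R :=
  if x \in A then #|A|%:R^-1 else 0.

(* The product over the edges encodes independence. *)
Definition matching_law (R : realType) (G : sgraph) (k : nat)
    (w : outcome G k) : R :=
  \prod_(f : edge G) uniform_on R (matchings k (val f)) (w f).

Definition dp_colorable_prob (R : realType) (G : sgraph) (k : nat) : R :=
  \sum_(w : outcome G k | colorable (cover_of w)) matching_law R w.

Local Close Scope ring_scope.


Section Facts.
Variables (G : sgraph) (k : nat).

Lemma edgesP (f : {set G}) :
  reflect (exists u v, adj u v /\ f = [set u; v]) (f \in edges G).
Proof.
rewrite inE; apply: (iffP existsP) => [[u /existsP[v /andP[uv /eqP->]]]|].
  by exists u, v.
by move=> [u [v [uv ->]]]; exists u; apply/existsP; exists v; rewrite uv eqxx.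
Qed.

Lemma adj_neq (u v : G) : adj u v -> u != v.
Proof. by apply: contraTneq => ->; rewrite adj_irrefl. Qed.

Lemma set2_inj (V : finType) (x y z t : V) :
  [set x; y] = [set z; t] -> (x = z /\ y = t) \/ (x = t /\ y = z).
Proof.
move=> E.
have xE : x \in [set z; t] by rewrite -E set21.
have yE : y \in [set z; t] by rewrite -E set22.
have zE : z \in [set x; y] by rewrite E set21.
have tE : t \in [set x; y] by rewrite E set22.
move: xE yE zE tE; rewrite !inE.
by do 4! (case/orP => /eqP ?); subst; auto.
Qed.

Lemma perfect_matchingC (V : finType) (A B : {set V}) M :
  perfect_matching A B M -> perfect_matching B A M.
Proof.
case/and3P => /forall_inP H t c; apply/and3P; split => //; last by rewrite setUC.
apply/forall_inP => a /H /exists_inP[x xA /exists_inP[y yB /eqP->]].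
by apply/exists_inP; exists y => //; apply/exists_inP; exists x => //; rewrite setUC.
Qed.

Lemma matchingsP (u v : G) M :
  (M \in matchings k [set u; v]) =
  perfect_matching (fiber k u) (fiber k v) M.
Proof.
rewrite inE; apply/existsP/idP => [[u' /existsP[v' /andP[/eqP/set2_inj]]]|H].
  by case=> [[-> ->]//|[-> ->]] /perfect_matchingC.
by exists u; apply/existsP; exists v; rewrite eqxx.
Qed.

Lemma matchings_ends f M x y : M \in matchings k f -> [set x; y] \in M ->
  f \in edges G -> x != y -> f = [set x.1; y.1].
Proof.
move=> Mf xyM /edgesP[u [v [uv Ef]]] xy; move: Mf; rewrite Ef matchingsP.
case/and3P => /forall_inP/(_ _ xyM)/exists_inP[x0 ux0 /exists_inP[y0 vy0]] + _ _.
move: ux0 vy0; rewrite !inE => /eqP <- /eqP <- /eqP/set2_inj.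
by case=> [[-> ->]//|[-> ->]]; rewrite setUC.
Qed.

Lemma cover_of_is_dp_cover (w : outcome G k) :
  (forall f, w f \in matchings k (val f)) -> is_dp_cover (cover_of w).
Proof.
move=> wM.
have key (x y : cover_graph (cover_of w)) : adj x y ->
    exists f : edge G, val f = [set x.1; y.1] /\ [set x; y] \in w f.
  case/andP => xy /bigcupP[f _ H]; exists f; split=> //.
  exact: matchings_ends (wM f) H (valP f) xy.
have key2 (x y : cover_graph (cover_of w)) : adj x y -> adj x.1 y.1.
  move=> /key[f [Ef _]]; have /edgesP[u [v [uv]]] := valP f.
  by rewrite Ef => /set2_inj[[-> ->]//|[-> ->]]; rewrite adj_sym.
split.
- move=> x; exists x.1; split; first by rewrite inE.
  by move=> v; rewrite inE => /eqP.
- move=> v; apply/forall_inP => x xv; apply/forall_inP => y yv.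
  apply/negP => /key2; move: xv yv; rewrite !inE => /eqP-> /eqP->.
  by rewrite adj_irrefl.
- move=> u v x uv; rewrite inE => /eqP xu; apply/card_le1_eqP => y z.
  rewrite !inE => /andP[/eqP yv xy] /andP[/eqP zv xz].
  have [f [Ef yf]] := key _ _ xy; have [g [Eg zg]] := key _ _ xz.
  have Efg : f = g by apply: val_inj; rewrite Ef Eg yv zv.
  subst g; have := wM f; rewrite Ef matchingsP => /and3P[_ /trivIsetP t _].
  have /set2_inj[[//]|[xz' yx]] : [set x; y] = [set x; z]; last by rewrite yx -xz'.
  apply/eqP; apply: contraT => /(t _ _ yf zg) /pred0P/(_ x) /=.
  by rewrite !inE eqxx.
- by move=> u v x y; rewrite !inE => /eqP<- /eqP<-; exact: key2.
Qed.

Definition perm_matching (u v : G) (s : 'S_k) : {set {set G * 'I_k}} :=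
  [set [set (u, i); (v, s i)] | i : 'I_k].

Lemma perm_matchingP (u v : G) (s : 'S_k) : u != v ->
  perm_matching u v s \in matchings k [set u; v].
Proof.
move=> uv; rewrite matchingsP; apply/and3P; split.
- apply/forall_inP => _ /imsetP[i _ ->].
  apply/exists_inP; exists (u, i); first by rewrite inE.
  by apply/exists_inP; exists (v, s i); rewrite ?inE.
- apply/trivIsetP => _ _ /imsetP[i _ ->] /imsetP[j _ ->].
  case: (eqVneq i j) => [->|ij _]; first by rewrite eqxx.
  apply/pred0P => x /=; apply/negP; rewrite !inE.
  case/andP => /orP[]/eqP-> /orP[]; rewrite xpair_eqE ?(negPf uv) ?(negPf ij) //=.
  + by rewrite andbF.
  + by rewrite eq_sym (negPf uv).
  + by rewrite (inj_eq perm_inj) (negPf ij) andbF.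
- apply/eqP/setP => -[t i]; rewrite !inE /=; apply/bigcupP/orP.
    by move=> [_ /imsetP[j _ ->]]; rewrite !inE !xpair_eqE => /orP[]/andP[-> _]; auto.
  case=> /eqP->.
    by exists [set (u, i); (v, s i)]; [apply/imsetP; exists i|rewrite set21].
  exists [set (u, (s^-1)%g i); (v, i)]; last by rewrite set22.
  by apply/imsetP; exists ((s^-1)%g i) => //; rewrite permKV.
Qed.

Lemma perm_matching_inj (u v : G) : u != v -> injective (perm_matching u v).
Proof.
move=> uv s t E; apply/permP => i.
have : [set (u, i); (v, s i)] \in perm_matching u v t.
  by rewrite -E; apply/imsetP; exists i.
case/imsetP => j _ /set2_inj[[[->] [->]]//|[[uv' _] _]].
by rewrite uv' eqxx in uv.
Qed.

Lemma perm_matching_surj (u v : G) M : u != v ->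
  M \in matchings k [set u; v] -> exists s, M = perm_matching u v s.
Proof.
move=> uv; rewrite matchingsP => /and3P[/forall_inP HM /trivIsetP t /eqP c].
have shape a : a \in M -> exists i j, a = [set (u, i); (v, j)].
  move=> /HM /exists_inP[[u' i] + /exists_inP[[v' j] + /eqP->]].
  by rewrite !inE /= => /eqP-> /eqP->; exists i, j.
have same a b x : a \in M -> b \in M -> x \in a -> x \in b -> a = b.
  move=> aM bM xa xb; apply/eqP; apply: contraT => /(t _ _ aM bM)/pred0P/(_ x).
  by rewrite /= xa xb.
have pair0 i : exists j, [set (u, i); (v, j)] \in M.
  have : (u, i) \in finset.cover M by rewrite c !inE eqxx.
  case/bigcupP => a aM; have [i' [j Ea]] := shape _ aM.
  rewrite Ea !inE !xpair_eqE eqxx (negPf uv) orbF /= => /eqP ->.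
  by exists j; rewrite -Ea.
have pairb i : exists j, [set (u, i); (v, j)] \in M by exact: pair0.
pose g i := xchoose (pairb i).
have gM i : [set (u, i); (v, g i)] \in M by exact: (xchooseP (pairb i)).
have g_inj : injective g.
  move=> i j E; have := same _ _ (v, g i) (gM i) (gM j).
  rewrite {3}E !set22 => /(_ isT isT) /set2_inj[[[]]//|[[uv' _] _]].
  by rewrite uv' eqxx in uv.
exists (perm g_inj); apply/setP => a; apply/idP/imsetP => [aM|[i _ ->]].
  have [i [j Ea]] := shape _ aM; exists i => //; rewrite permE.
  by apply: (same _ _ (u, i) aM (gM i)); rewrite ?Ea set21.
by rewrite permE.
Qed.

Lemma card_matchings f : f \in edges G -> #|matchings k f| = k`!.
Proof.
case/edgesP => u [v [/adj_neq uv ->]].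
have -> : matchings k [set u; v] = [set perm_matching u v s | s : 'S_k].
  apply/setP => M; apply/idP/imsetP => [/(perm_matching_surj uv)[s ->]|[s _ ->]].
    by exists s.
  exact: perm_matchingP.
rewrite (card_imset _ (perm_matching_inj uv)).
by rewrite -card_Sn; apply: eq_card => s; rewrite !inE.
Qed.

End Facts.

Lemma matching_law_sum1 (R : realType) (G : sgraph) (k : nat) :
  (\sum_(w : outcome G k) matching_law R w = 1)%R.
Proof.
rewrite /matching_law -(bigA_distr_bigA
  (fun f M => uniform_on R (matchings k (val f)) M)) /=.
rewrite big1 // => f _; rewrite -big_mkcond /= sumr_const.
by rewrite card_matchings ?(valP f) // -[LHS]mulr_natl divff // pnatr_eq0 -lt0n fact_gt0.
Qed.

(* Main.v *)
Require Import Defs.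
From mathcomp Require Import all_boot all_order all_algebra all_fingroup.
From mathcomp Require Import reals sequences exp.
From mathcomp Require Import ring lra.
Import Order.TTheory GRing.Theory Num.Theory.
Local Open Scope ring_scope.

Set Implicit Arguments.
Unset Strict Implicit.
Unset Printing Implicit Defensive.

(** Colour the vertices greedily along an order in which every vertex has at
    most [d] earlier neighbours, giving each vertex some colour that its earlier
    neighbours do not forbid.  When [v] is reached, the matchings between [v] and
    its earlier neighbours have not been looked at yet, so conditionally on the
    colours chosen so far every earlier neighbour forbids a uniformly random
    colour at [v], independently of the others.  Getting stuck at [v] thus means
    that at most [d] independent uniform balls hit each of [k] bins.

    A given bin is hit by [d] balls with probability [1 - (1 - 1/k)^d], and the
    events that different bins are hit are negatively correlated, so all bins are
    hit with probability at most [(1 - (1 - 1/k)^d)^k] ([coupon_collector]).  A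
    union bound over the [n] vertices bounds the probability that the greedy
    colouring gets stuck anywhere by [n (1 - (1 - 1/k)^d)^k]
    ([dp_colorable_prob_ge]), which is at most [n exp (- k (1 - 1/k)^d)].

    It remains to see that the expected number [k (1 - 1/k)^d] of free colours is
    at least [ln n + ln (1/eps)].  As [k] is at least [(1 + eps) d / ln d], it is
    at least [d^(eps / (1 + eps)) / ln d] up to a constant factor, and this beats
    [d^(eps/2)], hence [ln n], because [eps < 1] makes [eps / (1 + eps)] larger
    than [eps / 2] ([expected_free_ge]). *)

(** * Resampling one coordinate of a product law *)

Section ProductLaw.
Variables (R : realFieldType) (I T : finType) (mu : I -> T -> R).
Hypothesis mu_sum1 : forall i, \sum_t mu i t = 1.

Definition product_law (w : {ffun I -> T}) : R := \prod_i mu i (w i).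

Definition update (w : {ffun I -> T}) (i : I) (t : T) : {ffun I -> T} :=
  [ffun j => if j == i then t else w j].

Lemma product_law_sum1 : \sum_w product_law w = 1.
Proof.
rewrite /product_law -(bigA_distr_bigA (fun i t => mu i t)) big1 // => i _.
Qed.

Lemma product_law_update w i t :
  product_law (update w i t) * mu i (w i) = product_law w * mu i t.
Proof.
rewrite /product_law (bigD1 i) //= [in RHS](bigD1 i) //= ffunE eqxx.
rewrite (eq_bigr (fun j => mu j (w j))) => [|j /negPf ji]; last by rewrite ffunE ji.
by rewrite mulrAC [RHS]mulrAC; congr (_ * _); exact: mulrC.
Qed.

(** Exchanging the old value at [i] with the fresh one is an involution of the
    pairs (configuration, fresh value), and it preserves their joint law. *)
Lemma expect_resample i (F : {ffun I -> T} -> R) :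
  \sum_w product_law w * F w =
  \sum_w product_law w * \sum_t mu i t * F (update w i t).
Proof.
transitivity (\sum_(p : {ffun I -> T} * T) product_law p.1 * mu i p.2 * F p.1).
  rewrite -(pair_bigA _ (fun w t => product_law w * mu i t * F w)) /=.
  apply: eq_bigr => w _; rewrite -mulr_suml -mulr_sumr mu_sum1 mulr1 //.
rewrite (reindex (fun p => (update p.1 i p.2, p.1 i))) /=; last first.
  exists (fun p => (update p.1 i p.2, p.1 i)) => -[w t] _ /=.
    congr (_, _); last by rewrite ffunE eqxx.
    by apply/ffunP => j; rewrite !ffunE; case: eqVneq => [->|].
  congr (_, _); last by rewrite ffunE eqxx.
  by apply/ffunP => j; rewrite !ffunE; case: eqVneq => [->|].
rewrite -(pair_bigA _ (fun w t => product_law (update w i t) * mu i (w i) *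
  F (update w i t))) /=.
apply: eq_bigr => w _; rewrite mulr_sumr; apply: eq_bigr => t _.
by rewrite product_law_update mulrA.
Qed.

End ProductLaw.

(** * Covering a set of colours by independent uniform ones *)

Section CouponCollector.
Variable R : realFieldType.

Lemma bernoulli_exprD (x y : R) n : 0 <= x -> 0 <= y ->
  x ^+ n.+1 + n.+1%:R * x ^+ n * y <= (x + y) ^+ n.+1.
Proof.
move=> x0 y0; elim: n => [|n IH]; first by rewrite expr0 !expr1 mulr1 mul1r.
rewrite [leRHS]exprS; apply: le_trans (_ : _ <= (x + y) * _) _; last first.
  by apply: ler_wpM2l IH; exact: addr_ge0.
rewrite -subr_ge0 [X in 0 <= X](_ : _ = n.+1%:R * x ^+ n * y ^+ 2).
  by rewrite !mulr_ge0 ?exprn_ge0 ?ler0n.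
by rewrite !exprS -[n.+2]addn1 natrD; ring.
Qed.

Variables (I T : finType) (mu : I -> T -> R) (k : nat).
Hypothesis mu_sum1 : forall i, \sum_t mu i t = 1.

(** The random sets [X i] are uniformly random singletons given all coordinates
    other than [i], possibly by a rule that depends on coordinates outside [J].
    Adding a ball turns the question for [A] into the average over [c] of the
    question for [A :\ c], so with [x] the bound for one bin and [a] bins to hit
    the new probability is at most [x^a + a x^(a-1) (1 - x) / K], where
    [K = k.+1].  The new bound for one bin is [x + (1 - x) / K], and
    [bernoulli_exprD] compares the two; this stands in for negative
    correlation. *)
Lemma coupon_collector (X : I -> {ffun I -> T} -> {set 'I_k.+1})
    (J : seq I) (A : {set 'I_k.+1}) :
  uniq J ->
  (forall i j w t, i \in J -> j \in J -> i != j -> X j (update w i t) = X j w) ->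
  (forall i w (F : {set 'I_k.+1} -> R), i \in J ->
     \sum_t mu i t * F (X i (update w i t)) = k.+1%:R^-1 * \sum_c F [set c]) ->
  \sum_w product_law mu w * (A \subset \bigcup_(i <- J) X i w)%:R
    <= (1 - (1 - k.+1%:R^-1) ^+ size J) ^+ #|A|.
Proof.
elim: J A => [|e J IH] A.
  move=> _ _ _; under eq_bigr do rewrite big_nil subset0.
  rewrite -mulr_suml product_law_sum1 // mul1r expr0 subrr expr0n cards_eq0.
  exact: lexx.
move=> /= /andP[eJ uJ] Xind Xunif.
set q : R := 1 - k.+1%:R^-1; set x : R := 1 - q ^+ size J.
have K0 : 0 < k.+1%:R :> R by rewrite ltr0n.
have Kinv0 : 0 <= k.+1%:R^-1 :> R by rewrite invr_ge0 ltW.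
have Kinv1 : k.+1%:R^-1 <= 1 :> R by rewrite invf_le1 // ler1n.
have q0 : 0 <= q by rewrite subr_ge0.
have x0 : 0 <= x by rewrite subr_ge0 exprn_ile1 // gerBl.
have xle1 : x <= 1 by rewrite /x; have := exprn_ge0 (size J) q0; lra.
have {}IH (B : {set 'I_k.+1}) : \sum_w product_law mu w * (B \subset \bigcup_(i <- J) X i w)%:R
    <= x ^+ #|B|.
  apply: IH => // [i j w t iJ jJ|i w F iJ].
    by apply: Xind; rewrite inE ?iJ ?jJ orbT.
  by apply: Xunif; rewrite inE iJ orbT.
have step : \sum_w product_law mu w * (A \subset \bigcup_(i <- e :: J) X i w)%:R
    = k.+1%:R^-1 * \sum_c \sum_w product_law mu w *
        (A :\ c \subset \bigcup_(i <- J) X i w)%:R.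
  rewrite (expect_resample mu_sum1 e) exchange_big mulr_sumr /=.
  apply: eq_bigr => w _; rewrite -mulr_sumr mulrCA; congr (_ * _).
  under eq_bigr => t _.
    rewrite big_cons (eq_big_seq (fun i => X i w)) => [|i iJ]; last first.
      rewrite Xind ?inE ?iJ ?eqxx ?orbT //.
      by apply: contraNneq eJ => ->.
    over.
  rewrite (Xunif e w (fun S => (A \subset S :|: \bigcup_(i <- J) X i w)%:R)) ?mem_head //.
  by congr (_ * _); apply: eq_bigr => c _; rewrite subDset.
rewrite {}step.
(* For an empty [A] there is no bin left to remove, and both sides are 1. *)
have [A0|A0] := posnP #|A|.
  have -> : A = set0 by apply/eqP; rewrite -cards_eq0 A0.
  rewrite cards0 expr0 (eq_bigr (fun=> 1)) => [|c _]; last first.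
    under eq_bigr do rewrite set0D sub0set mulr1.
    exact: product_law_sum1.
  by rewrite sumr_const card_ord -[1 *+ _]/(_%:R) mulVf // gt_eqF.
have [a Ea] : exists a, #|A| = a.+1 by case: #|A| A0 => // a; exists a.
have aK : (a.+1 <= k.+1)%N by rewrite -Ea -[leqRHS]card_ord max_card.
apply: (@le_trans _ _ (k.+1%:R^-1 * \sum_(c : 'I_k.+1) x ^+ #|A :\ c|)).
  by rewrite ler_wpM2l // ler_sum.
have -> : \sum_(c : 'I_k.+1) x ^+ #|A :\ c|
    = a.+1%:R * x ^+ a + (k.+1%:R - a.+1%:R) * x ^+ a.+1.
  rewrite (bigID (mem A)) /=; congr (_ + _).
    rewrite (eq_bigr (fun=> x ^+ a)) => [|c cA].
      by rewrite sumr_const Ea mulr_natl.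
    by have := cardsD1 c A; rewrite cA Ea add1n => -[<-].
  rewrite (eq_bigr (fun=> x ^+ a.+1)) => [|c /negPf cA].
    rewrite sumr_const -natrB // mulr_natl; congr (_ *+ _).
    have := cardC A; rewrite card_ord Ea => E; rewrite -[in RHS]E addKn.
    exact: eq_card.
  by have := cardsD1 c A; rewrite cA Ea add0n => <-.
have -> : 1 - q ^+ (size J).+1 = x + k.+1%:R^-1 * (1 - x).
  by rewrite /x exprS {1}/q; ring.
rewrite Ea; apply: le_trans (bernoulli_exprD _ _ _) => //; last first.
  by rewrite mulr_ge0 // subr_ge0.
rewrite le_eqVlt; apply/orP; left; apply/eqP.
have Kn : k.+1%:R != 0 :> R by rewrite gt_eqF.
have -> : k.+1%:R^-1 * (a.+1%:R * x ^+ a + (k.+1%:R - a.+1%:R) * x ^+ a.+1) =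
  (k.+1%:R^-1 * k.+1%:R) * x ^+ a.+1 +
  k.+1%:R^-1 * (a.+1%:R * x ^+ a - a.+1%:R * x ^+ a.+1) by ring.
by rewrite mulVf // mul1r exprS; ring.
Qed.

End CouponCollector.

(** * The expected number of free colours *)

Section FreeColours.
Variable R : realType.
Implicit Types x y : R.

Lemma sqr_le_expR x : 0 <= x -> x ^+ 2 <= 4 * expR x.
Proof.
move=> x0; have h : x / 2 <= expR (x / 2).
  by apply: le_trans (expR_ge1Dx _); lra.
have -> : expR x = expR (x / 2) ^+ 2 by rewrite -expRM_natl; congr expR; field.
have : (x / 2) ^+ 2 <= expR (x / 2) ^+ 2 by rewrite lerXn2r // nnegrE ?expR_ge0 //; lra.
lra.
Qed.

(** The reciprocal of [1 - y] is [1 + y / (1 - y)], so this is the usual upper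
    bound on [1 + z] at [z = y / (1 - y)]. *)
Lemma expR_le_onemV y : 0 <= y -> y < 1 -> expR (- (y / (1 - y))) <= 1 - y.
Proof.
move=> y0 y1; rewrite expRN -[leRHS]invrK lef_pV2 ?posrE ?expR_gt0 ?invr_gt0 ?subr_gt0 //.
apply: le_trans (expR_ge1Dx _).
by rewrite le_eqVlt; apply/orP; left; apply/eqP; field; lra.
Qed.

(** Write [x = ln d] and let [t] be the lower bound on [k].  By
    [expR_le_onemV] the power [(1 - 1/k)^d] is at least [exp (- d / (k - 1))], and
    [d / (t - 1)] exceeds [d / t = x / (1 + eps)] by at most [2 d / t^2], which is
    bounded by 8.  What is left, [exp (eps / (1 + eps) * x)] up to a factor [x]
    and a constant, outgrows [exp (eps / 2 * x)] by the factor
    [exp (delta * x)]. *)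
Lemma expected_free_ge (eps : R) : 0 < eps -> eps < 1 ->
  exists2 x0 : R, 0 < x0 & forall d k : nat, x0 <= ln (d%:R : R) ->
    (1 + eps) * d%:R / ln (d%:R : R) <= k%:R ->
    expR (eps / 2 * ln (d%:R : R)) + ln eps^-1 <= k%:R * (1 - k%:R^-1) ^+ d.
Proof.
move=> e0 e1.
pose delta := eps / (1 + eps) - eps / 2.
have de0 : 0 < delta.
  rewrite [delta](_ : _ = eps * (1 - eps) / (2 * (1 + eps))); last by rewrite /delta; field; lra.
  by rewrite divr_gt0 ?mulr_gt0 //; lra.
have le0 : 0 <= ln eps^-1 by rewrite ln_ge0 // invf_ge1 // ltW.
pose C := expR 8 * (1 + ln eps^-1).
have C0 : 0 < C by rewrite mulr_gt0 ?expR_gt0 //; lra.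
exists (8 + 4 * C / delta ^+ 2) => [|d k].
  by rewrite addr_gt0 // divr_gt0 ?exprn_gt0 // mulr_gt0.
set x : R := ln _ => xge.
have Cd0 : 0 <= 4 * C / delta ^+ 2 by rewrite ltW // divr_gt0 ?exprn_gt0 // mulr_gt0.
have x8 : 8 <= x by lra.
have x0 : 0 < x by lra.
have dE : d%:R = expR x.
  rewrite lnK // posrE ltr0n lt0n; apply/negP => /eqP d0.
  by move: x0; rewrite /x d0 ln0 // ltxx.
set t : R := (1 + eps) * d%:R / x => tk.
have tE : t = (1 + eps) * expR x / x by rewrite /t dE.
have t0 : 0 < t by rewrite tE divr_gt0 ?mulr_gt0 ?expR_gt0 //; lra.
have texp : expR x / x <= t.
  rewrite tE ler_pM2r ?invr_gt0 // ler_peMl ?expR_ge0 //; lra.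
have t2 : 2 <= t.
  apply: le_trans texp; rewrite ler_pdivlMr //.
  have := sqr_le_expR (ltW x0); nra.
have kgt1 : 1 < k%:R :> R by lra.
have kinv : (0 <= k%:R^-1 :> R) && (k%:R^-1 < 1 :> R).
  rewrite invr_ge0 ler0n /= invf_lt1 //; lra.
have [kinv0 kinv1] := andP kinv.
have hexp : expR (- (x / (1 + eps) + 8)) <= (1 - k%:R^-1) ^+ d.
  apply: le_trans (_ : expR (- (k%:R^-1 / (1 - k%:R^-1))) ^+ d <= _); last first.
    rewrite lerXn2r ?nnegrE ?expR_ge0 ?expR_le_onemV //; lra.
  rewrite -expRM_natl ler_expR mulrN lerN2 dE.
  have -> : k%:R^-1 / (1 - k%:R^-1) = (k%:R - 1)^-1 :> R by field; lra.
  apply: le_trans (_ : expR x * (t - 1)^-1 <= _).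
    by rewrite ler_wpM2l ?expR_ge0 // lef_pV2 ?posrE; lra.
  have -> : (t - 1)^-1 = t^-1 + (t * (t - 1))^-1 by field; lra.
  have h : (t * (t - 1))^-1 <= 2 / t ^+ 2.
    rewrite -[2 / _]invrK lef_pV2 ?posrE; last 2 first.
    + by rewrite mulr_gt0 //; lra.
    + by rewrite invr_gt0 divr_gt0 ?exprn_gt0.
    rewrite invf_div ler_pdivrMr //; nra.
  rewrite mulrDr lerD //.
    rewrite tE invf_div mulrA le_eqVlt; apply/orP; left; apply/eqP.
    have := expR_gt0 x; move: (expR x) => y y0; field; lra.
  apply: le_trans (_ : expR x * (2 / t ^+ 2) <= _).
    by rewrite ler_wpM2l ?expR_ge0.
  rewrite mulrA ler_pdivrMr ?exprn_gt0 //.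
  apply: le_trans (_ : 8 * (expR x / x) ^+ 2 <= _); last first.
    by rewrite ler_pM2l // lerXn2r // nnegrE ?(ltW t0) // divr_ge0 ?expR_ge0 // ltW.
  rewrite expr_div_n mulrA ler_pdivlMr ?exprn_gt0 //.
  have := sqr_le_expR (ltW x0); have := expR_gt0 x; nra.
apply: le_trans (_ : expR x / x * expR (- (x / (1 + eps) + 8)) <= _); last first.
  apply: ler_pM; rewrite ?expR_ge0 ?divr_ge0 ?expR_ge0 ?(ltW x0) //.
  exact: le_trans texp tk.
have -> : expR x / x * expR (- (x / (1 + eps) + 8)) =
    expR (delta * x) / x * (expR 8)^-1 * expR (eps / 2 * x).
  rewrite mulrAC -expRD -expRN [RHS]mulrAC [in RHS]mulrAC -mulrA -!expRD.
  rewrite [RHS]mulrAC -expRD; congr (expR _ / _).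
  by rewrite /delta; field; lra.
(* The threshold on [x] makes [(delta * x)^2 / 4], a lower bound on
   [exp (delta * x)], reach [C * x]. *)
have big : 1 + ln eps^-1 <= expR (delta * x) / x * (expR 8)^-1.
  rewrite ler_pdivlMr ?expR_gt0 // ler_pdivlMr // [_ * expR 8]mulrC -/C.
  have : 4 * C <= delta ^+ 2 * x by rewrite -ler_pdivrMl ?exprn_gt0 // mulrC; lra.
  have := sqr_le_expR (mulr_ge0 (ltW de0) (ltW x0)).
  rewrite exprMn => h1 h2.
  have : x * (4 * C) <= x * (delta ^+ 2 * x) by rewrite ler_pM2l.
  nra.
have ee : 1 <= expR (eps / 2 * x).
  by rewrite -[leLHS]expR0 ler_expR mulr_ge0 //; lra.
apply: le_trans (ler_wpM2r (expR_ge0 _) big).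
nra.
Qed.

End FreeColours.

(** * A uniform perfect matching gives a uniform partner *)

Lemma sum_perm_apply (R : realFieldType) n (i : 'I_n.+1) (f : 'I_n.+1 -> R) :
  \sum_(s : 'S_n.+1) f (s i) = (n.+1)`!%:R / n.+1%:R * \sum_j f j.
Proof.
have same (j : 'I_n.+1) : \sum_(s : 'S_n.+1) f (s j) = \sum_(s : 'S_n.+1) f (s i).
  rewrite (reindex_inj (mulgI (tperm i j))) /=; apply: eq_bigr => s _.
  by rewrite permM tpermR.
have avg : n.+1%:R * \sum_(s : 'S_n.+1) f (s i) = (n.+1)`!%:R * \sum_j f j.
  transitivity (\sum_(j < n.+1) \sum_(s : 'S_n.+1) f (s j)).
    by rewrite (eq_bigr _ (fun j _ => same j)) sumr_const card_ord mulr_natl.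
  rewrite exchange_big /= (eq_bigr (fun=> \sum_j f j)) => [|s _].
    rewrite sumr_const mulr_natl; congr (_ *+ _); rewrite -card_Sn.
    by apply: eq_card => s; rewrite !inE.
  by rewrite [RHS](reindex_inj (@perm_inj _ s)).
by rewrite mulrAC -avg mulrC mulKf // pnatr_eq0.
Qed.

Lemma uniform_on_ge0 (R : realType) (S : finType) (A : {set S}) x :
  0 <= uniform_on R A x.
Proof. by rewrite /uniform_on; case: ifP => // _; rewrite invr_ge0 ler0n. Qed.

Lemma uniform_on_sum1 (R : realType) (S : finType) (A : {set S}) :
  A != set0 -> \sum_x uniform_on R A x = 1.
Proof.
move=> A0; rewrite -big_mkcond /= sumr_const -[LHS]mulr_natl divff //.
by rewrite pnatr_eq0 cards_eq0.
Qed.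

Lemma uniform_partner (R : realType) (G : sgraph) (k : nat) (u v : G)
    (i : 'I_k.+1) (F : {set 'I_k.+1} -> R) : adj u v ->
  \sum_M uniform_on R (matchings k.+1 [set u; v]) M *
    F [set j | [set (u, i); (v, j)] \in M] = k.+1%:R^-1 * \sum_c F [set c].
Proof.
move=> uvE; have uv := adj_neq uvE.
have matE : matchings k.+1 [set u; v] = [set perm_matching u v s | s : 'S_k.+1].
  apply/setP => M; apply/idP/imsetP => [/(perm_matching_surj uv)[s ->]|[s _ ->]].
    by exists s.
  exact: perm_matchingP.
have cardE : #|matchings k.+1 [set u; v]| = (k.+1)`!.
  by apply: card_matchings; apply/edgesP; exists u, v.
rewrite (bigID (mem (matchings k.+1 [set u; v]))) /= addrC big1 ?add0r; last first.
  by move=> M /negPf ME; rewrite /uniform_on ME mul0r.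
under eq_bigr => M ME do rewrite /uniform_on ME cardE.
rewrite -mulr_sumr matE big_imset /=; last by move=> s t _ _; exact: perm_matching_inj.
under eq_bigr => s _.
  rewrite (_ : [set j | _] = [set s i]); last first.
    apply/setP => j; rewrite !inE; apply/imsetP/eqP => [[i' _]|->]; last by exists i.
    by case/set2_inj => [[[->] [->]]//|[[Euv]]]; rewrite Euv eqxx in uv.
  over.
rewrite (eq_bigl xpredT) => [|s]; last by rewrite !inE.
rewrite (sum_perm_apply i (fun j => F [set j])) mulrA mulrA mulVf ?mul1r //.
by rewrite pnatr_eq0 -lt0n fact_gt0.
Qed.

(** * Greedy colouring of a random cover *)

Section Greedy.
Variables (G : sgraph) (k : nat).
Implicit Types (w : outcome G k.+1) (rs : seq G) (c : G -> 'I_k.+1).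

(** When [f] is an edge at [v] and [c] colours its other end, these are the
    colours at [v] matched to that colour; the other end is quantified because an
    edge does not name it. *)
Definition forbidden (f : {set G}) (M : {set {set G * 'I_k.+1}}) c v :
    {set 'I_k.+1} :=
  [set j | [exists u, (f == [set u; v]) && ([set (u, c u); (v, j)] \in M)]].

Definition back_edges rs v : {set edge G} :=
  [set e : edge G | [exists u in rs, val e == [set u; v]]].

Definition blocked w c rs v : {set 'I_k.+1} :=
  \bigcup_(e in back_edges rs v) forbidden (val e) (w e) c v.

(** The list is in reverse order of colouring: its head is coloured last.  A
    stuck vertex gets the default colour, which keeps the colouring total and
    lets the bad events at different vertices be bounded separately. *)
Fixpoint greedy w rs : G -> 'I_k.+1 :=
  if rs is v :: rs' then
    fun x => if x == v then odflt ord0 [pick j | j \notin blocked w (greedy w rs') rs' v]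
             else greedy w rs' x
  else fun=> ord0.

Fixpoint never_stuck w rs : bool :=
  if rs is v :: rs' then
    never_stuck w rs' && (blocked w (greedy w rs') rs' v != setT)
  else true.

Fixpoint back_degree_le d rs : bool :=
  if rs is v :: rs' then
    back_degree_le d rs' && (#|back_edges rs' v| <= d)%N
  else true.

Lemma back_edgesP rs v (e : edge G) :
  reflect (exists2 u, u \in rs & val e = [set u; v]) (e \in back_edges rs v).
Proof.
rewrite inE; apply: (iffP exists_inP) => -[u urs].
  by move/eqP; exists u.
by move=> ->; exists u.
Qed.

Lemma edge_adj (e : edge G) u v : val e = [set u; v] -> adj u v.
Proof.
have /edgesP[x [y [xy ->]]] := valP e.
by case/set2_inj => -[<- <-] //; rewrite adj_sym.
Qed.

Lemma forbiddenE (e : edge G) u v M c : val e = [set u; v] ->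
  forbidden (val e) M c v = [set j | [set (u, c u); (v, j)] \in M].
Proof.
move=> E; apply/setP => j; rewrite !inE.
apply/existsP/idP => [[x /andP[/eqP]]|H]; last by exists u; rewrite E eqxx.
rewrite E => /set2_inj[[-> _] //|[Euv _]].
by have := edge_adj E; rewrite Euv adj_irrefl.
Qed.

Lemma forbidden_ext f M c c' v : c =1 c' -> forbidden f M c v = forbidden f M c' v.
Proof. by move=> cc; apply/setP => j; rewrite !inE; under eq_existsb do rewrite cc. Qed.

Lemma blocked_ext w w' c c' rs v :
  c =1 c' -> {in back_edges rs v, w =1 w'} ->
  blocked w c rs v = blocked w' c' rs v.
Proof.
move=> cc ww; apply: eq_bigr => e eB.
by rewrite (forbidden_ext _ _ _ cc) ww.
Qed.

(** Colours given before [v] is reached do not depend on the matchings at [v]: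
    this is what makes those matchings fresh when [v] is coloured. *)
Lemma greedy_update w (e : edge G) M rs v : v \in val e -> v \notin rs ->
  greedy (update w e M) rs =1 greedy w rs.
Proof.
move=> ve; elim: rs => [//|y rs IH]; rewrite inE negb_or => /andP[vy vrs] x /=.
rewrite (IH vrs) (blocked_ext (IH vrs) (w' := w)) // => f /back_edgesP[u urs Ef].
rewrite ffunE; case: eqVneq => // fe.
move: ve; rewrite -fe Ef !inE (negPf vy) orbF => /eqP vu.
by rewrite vu urs in vrs.
Qed.

Lemma greedy_proper w rs : uniq rs -> never_stuck w rs ->
  {in rs &, forall u v (e : edge G), val e = [set u; v] ->
     [set (u, greedy w rs u); (v, greedy w rs v)] \notin w e}.
Proof.
elim: rs => [//|y rs IH] /= /andP[yrs urs] /andP[good nblock].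
have last_ok u (e : edge G) : u \in rs -> val e = [set u; y] ->
    [set (u, greedy w rs u);
         (y, odflt ord0 [pick j | j \notin blocked w (greedy w rs) rs y])] \notin w e.
  move=> u_rs Ee; case: pickP => [j jb|allb] /=.
    apply: contra jb => jw; apply/bigcupP; exists e; last by rewrite (forbiddenE _ _ Ee) inE.
    by apply/back_edgesP; exists u.
  case/negP: nblock; apply/eqP/setP => j; rewrite inE.
  by have := allb j; case: (j \in _).
have ne x : x \in rs -> (x == y) = false.
  by move=> xrs; apply/negP => /eqP xy; rewrite -xy xrs in yrs.
move=> u v; rewrite !inE => /orP[/eqP->|u_rs] /orP[/eqP->|v_rs] e Ee.
- by have := edge_adj Ee; rewrite adj_irrefl.
- rewrite eqxx (ne _ v_rs) setUC; apply: last_ok => //; exact: etrans Ee (setUC _ _).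
- by rewrite eqxx (ne _ u_rs); apply: last_ok.
- by rewrite (ne _ u_rs) (ne _ v_rs); apply: IH.
Qed.

Lemma never_stuck_colorable w rs :
  (forall f, w f \in matchings k.+1 (val f)) ->
  uniq rs -> (forall v, v \in rs) -> never_stuck w rs -> colorable (cover_of w).
Proof.
move=> wM urs allrs good; pose c := greedy w rs.
apply/existsP; exists [set (v, c v) | v : G]; apply/andP; split.
  apply/forallP => v; apply/cards1P; exists (v, c v).
  apply/setP => -[x i]; rewrite !inE; apply/andP/eqP => [[/imsetP[u _ [-> ->]]]|].
    by move=> /eqP /= ->.
  by move=> [-> ->]; rewrite /= eqxx; split=> //; apply/imsetP; exists v.
apply/forall_inP => _ /imsetP[u _ ->]; apply/forall_inP => _ /imsetP[v _ ->].
apply/negP => /andP[uv /bigcupP[f _ uvf]].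
have Ef := matchings_ends (wM f) uvf (valP f) uv.
by move: uvf; apply/negP; exact: greedy_proper.
Qed.

Variable R : realType.

Let mu (e : edge G) M : R := uniform_on R (matchings k.+1 (val e)) M.

Let mu_ge0 e M : 0 <= mu e M. Proof. exact: uniform_on_ge0. Qed.

Let mu_sum1 e : \sum_M mu e M = 1.
Proof.
apply: uniform_on_sum1; rewrite -card_gt0 card_matchings ?fact_gt0 //.
exact: valP.
Qed.

(** The bound of [coupon_collector] for covering all [k.+1] colours by [d] balls. *)
Definition cover_bound d : R := (1 - (1 - k.+1%:R^-1) ^+ d) ^+ k.+1.

Lemma blocked_prob d rs v : v \notin rs -> (#|back_edges rs v| <= d)%N ->
  \sum_w matching_law R w * (blocked w (greedy w rs) rs v == setT)%:R
    <= cover_bound d.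
Proof.
move=> vrs degv.
pose X (e : edge G) w := forbidden (val e) (w e) (greedy w rs) v.
have v_in e : e \in enum (back_edges rs v) -> v \in val e.
  by rewrite mem_enum => /back_edgesP[u _ ->]; rewrite set22.
have := @coupon_collector R _ _ mu k mu_sum1 X (enum (back_edges rs v)) setT.
rewrite enum_uniq -cardE cardsT card_ord => /(_ isT) H.
apply: le_trans (le_trans (H _ _) _).
- rewrite le_eqVlt; apply/orP; left; apply/eqP; apply: eq_bigr => w _.
  by rewrite big_enum /= subTset.
- move=> e f w M eJ fJ ef; rewrite /X (forbidden_ext _ _ _ (greedy_update _ _ (v_in _ eJ) vrs)).
  by rewrite ffunE eq_sym (negPf ef).
- move=> e w F eJ; move: (eJ); rewrite mem_enum => /back_edgesP[u urs Ee].
  have adj_uv := edge_adj Ee; rewrite -(uniform_partner (greedy w rs u) F adj_uv).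
  apply: eq_bigr => M _; rewrite /mu Ee; congr (_ * F _).
  rewrite /X (forbidden_ext _ _ _ (greedy_update _ _ (v_in _ eJ) vrs)).
  by rewrite ffunE eqxx (forbiddenE _ _ Ee).
have kinv : 0 <= 1 - k.+1%:R^-1 :> R by rewrite subr_ge0 invf_le1 ?ler1n ?ltr0n.
have kinv1 : 1 - k.+1%:R^-1 <= 1 :> R by rewrite gerBl invr_ge0.
rewrite lerXn2r ?nnegrE ?subr_ge0 ?exprn_ile1 //.
by rewrite lerD2l lerN2 ler_wiXn2l.
Qed.

Lemma stuck_prob d rs : uniq rs -> back_degree_le d rs ->
  \sum_w matching_law R w * (~~ never_stuck w rs)%:R <= (size rs)%:R * cover_bound d.
Proof.
elim: rs => [_ _|v rs IH] /=.
  by rewrite mul0r big1 // => w _; rewrite mulr0.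
case/andP => vrs urs /andP[degs degv].
apply: le_trans (_ : \sum_w (matching_law R w * (~~ never_stuck w rs)%:R +
   matching_law R w * (blocked w (greedy w rs) rs v == setT)%:R) <= _).
  apply: ler_sum => w _; rewrite -mulrDr ler_wpM2l ?prodr_ge0 // => [i _|].
    exact: mu_ge0.
  by rewrite negb_and negbK -natrD ler_nat; case: (never_stuck w rs); case: (_ == _).
rewrite big_split /= -[(size rs).+1]addn1 natrD mulrDl mul1r.
by rewrite lerD ?IH ?blocked_prob.
Qed.

Lemma dp_colorable_prob_ge d rs : uniq rs -> (forall v, v \in rs) ->
  back_degree_le d rs ->
  1 - #|G|%:R * cover_bound d <= dp_colorable_prob R G k.+1.
Proof.
move=> urs allrs degs.
have szE : size rs = #|G|.
  by rewrite -(card_uniqP urs); apply: eq_card => v; rewrite allrs.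
rewrite lerBlDl -szE; apply: le_trans (lerD (stuck_prob urs degs) (lexx _)).
rewrite -[leLHS](matching_law_sum1 R G k.+1) /dp_colorable_prob [X in _ + X]big_mkcond -big_split /=.
apply: ler_sum => w _.
have law0 : 0 <= matching_law R w by apply: prodr_ge0 => e _; exact: mu_ge0.
(* An outcome with a value that is not a perfect matching has probability 0. *)
have [wM|] := boolP [forall f, w f \in matchings k.+1 (val f)].
  have [good|_] := boolP (never_stuck w rs).
    rewrite (@never_stuck_colorable w rs) ?mulr0 ?add0r //.
    exact/forallP.
  by rewrite mulr1 lerDl; case: ifP.
rewrite negb_forall => /existsP[f /negPf wf].
have -> : matching_law R w = 0.
  by apply/eqP/prodf_eq0; exists f; rewrite // /uniform_on wf.
by rewrite mul0r add0r; case: ifP.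
Qed.

End Greedy.

Lemma degenerate_order (G : sgraph) d : degenerate G d ->
  exists rs : seq G, [/\ uniq rs, forall v, v \in rs & back_degree_le d rs].
Proof.
case=> s [us alls degs]; exists (rev s); split=> [|v|]; rewrite ?rev_uniq ?mem_rev //.
have: exists p, p ++ rev s = rev s by exists [::].
elim: {1 3}(rev s) => [//|v rs IH] [p Ep] /=; apply/andP; split.
  by apply: IH; exists (rcons p v); rewrite cat_rcons.
apply: leq_trans (degs v).
have sE : s = rev rs ++ v :: rev p.
  by rewrite -[s]revK -Ep rev_cat rev_cons -cats1 -catA.
(* Back edges are counted by their earlier ends. *)
rewrite -(card_imset _ val_inj).
apply: leq_trans (leq_imset_card (fun u => [set u; v]) _).
apply/subset_leq_card/subsetP => _ /imsetP[e /back_edgesP[u urs Ee] ->].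
apply/imsetP; exists u => //; rewrite inE (edge_adj Ee) sE.
have urs' : u \in rev rs by rewrite mem_rev.
move: us; rewrite sE cat_uniq /= => /and3P[_ /norP[vrs _] _].
by rewrite !index_cat urs' (negPf vrs) /= eqxx addn0 index_mem.
Qed.

(** * Conclusion *)

Lemma exprB_le_expR (R : realType) (y : R) n : y <= 1 ->
  (1 - y) ^+ n <= expR (- (n%:R * y)).
Proof.
move=> y1; rewrite -mulrN expRM_natl lerXn2r ?nnegrE ?expR_ge0 ?subr_ge0 //.
exact: expR_ge1Dx.
Qed.

Theorem theorem1p3 (R : realType) (eps : R) (eps_gt0 : 0 < eps)
    (eps_lt : eps < 1 / 2) :
  exists n0 : nat, forall (G : sgraph) (d k : nat),
    (n0 <= #|G|)%N ->
    is_degeneracy G d ->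
    ln (#|G|%:R : R) `^ (2 / eps) <= d%:R ->
    (1 + eps) * d%:R / ln (d%:R : R) <= k%:R ->
    1 - eps <= dp_colorable_prob R G k.
Proof.
have [x0 x0_gt0 free] : exists2 x0 : R, 0 < x0 & _ :=
  expected_free_ge eps_gt0 (ltac:(lra) : eps < 1).
(* [eps / 2 * x0] is where [ln n <= d^(eps/2)] forces [ln d >= x0]. *)
exists (Num.bound (expR (expR (eps / 2 * x0)))) => G d k nG [degG _] lnn kge.
set n := #|G| in nG lnn *.
have n_large : expR (expR (eps / 2 * x0)) < n%:R.
  apply: lt_le_trans (archi_boundP (expR_ge0 _)) _; by rewrite ler_nat.
have n_gt0 : 0 < n%:R :> R by apply: lt_trans n_large; exact: expR_gt0.
have ln_large : expR (eps / 2 * x0) < ln (n%:R : R).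
  by rewrite -ltr_expR lnK // posrE.
have ln_gt0 : 0 < ln (n%:R : R) by apply: lt_trans ln_large; exact: expR_gt0.
have d_gt0 : 0 < d%:R :> R by apply: lt_le_trans lnn; exact: powR_gt0.
have lnd : 2 / eps * ln (ln (n%:R : R)) <= ln (d%:R : R).
  by rewrite -ln_powR ler_ln ?posrE ?powR_gt0.
have lnn_le : ln (n%:R : R) <= expR (eps / 2 * ln (d%:R : R)).
  rewrite -[leLHS]lnK ?posrE // ler_expR.
  by rewrite -ler_pdivrMl ?divr_gt0 // invf_div.
have d_large : x0 <= ln (d%:R : R).
  have h : expR (eps / 2 * x0) <= expR (eps / 2 * ln (d%:R : R)).
    exact: le_trans (ltW ln_large) lnn_le.
  by rewrite ler_expR ler_pM2l ?divr_gt0 in h.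
have {free} := free d k d_large kge.
have k_gt0 : (0 < k)%N.
  rewrite -(ltr0n R); apply: lt_le_trans kge.
  by rewrite !mulr_gt0 ?invr_gt0 //; [lra|exact: lt_le_trans d_large].
case: k k_gt0 {kge} => // k _ free.
have [rs [urs allrs degs]] := degenerate_order degG.
apply: le_trans (dp_colorable_prob_ge k R urs allrs degs).
rewrite lerD2l lerN2 -/n.
apply: le_trans (_ : n%:R * expR (- (k.+1%:R * (1 - k.+1%:R^-1) ^+ d)) <= _).
  rewrite ler_pM2l // exprB_le_expR // exprn_ile1 ?gerBl ?invr_ge0 //.
  by rewrite subr_ge0 invf_le1 ?ler1n ?ltr0n.
rewrite -[n%:R]lnK ?posrE // -expRD -[leRHS]lnK ?posrE // ler_expR.
have := lnV eps_gt0 ; lra.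
Qed.
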